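(* Let $q$ be a prime power and let $m,k$ be positive integers. The number of $[mk,k,m]_{\mathbb{F}_{q^m}}$-codes (in $\mathbb{F}_{q^m}^{mk}$) is $$\frac{|\mathrm{GL}_{mk}(q)|}{(q^{mk}-1)(q^{mk}-q^m)\cdots(q^{mk}-q^{m(k-1)})}.$$
   Context: The rank $\mathrm{rk}(v)$ of $v\in\mathbb{F}_{q^m}^n$ is the dimension over $\mathbb{F}_q$ of the $\mathbb{F}_q$-span of its entries. An $[n,k,d]_{\mathbb{F}_{q^m}}$-code is a $k$-dimensional $\mathbb{F}_{q^m}$-linear subspace $C\le\mathbb{F}_{q^m}^n$, $k\ge1$, whose minimum distance $\min\{\mathrm{rk}(v): v\in C,\ v\neq0\}$ equals $d$. $\mathrm{GL}_{mk}(q)$ is the group of invertible $mk\times mk$ matrices over $\mathbb{F}_q$. *)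

(* Defs.v *)
From HB Require Import structures.
From mathcomp Require Import all_boot all_order all_algebra all_fingroup all_field.

Set Implicit Arguments.
Unset Strict Implicit.
Unset Printing Implicit Defensive.

Import GRing.Theory.
Local Open Scope ring_scope.

(* A subspace is a subtype of the coordinate matrices, so over a finite field
   there are finitely many subspaces and they can be counted. *)
Section FiniteVspace.

Import VectorInternalTheory.
Variables (K : finFieldType) (vT : vectType K).

HB.instance Definition _ := [Finite of {vspace vT} by <:].

End FiniteVspace.

Definition rank_weight (F : fieldType) (L : fieldExtType F) (n : nat)
    (v : 'rV[L]_n) : nat :=
  \dim (<<[seq v 0%R i | i : 'I_n]>>%VS : {vspace L}).

Section Codes.

Variables (F : finFieldType) (L : fieldExtType F) (n : nat).

(* [finvect_type L] is L itself, carrying its finite field structure together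
   with its structure of extension of F. *)
Local Notation K := (finvect_type L).

(* The minimum of the rank weights of the nonzero vectors of C exists and is d;
   in particular this is false for the zero code. *)
Definition has_min_distance (C : {vspace 'rV[K]_n}) (d : nat) : bool :=
  [exists v : 'rV[K]_n, [&& v \in C, v != 0 & rank_weight v == d]] &&
  [forall v : 'rV[K]_n, (v \in C) && (v != 0) ==> (d <= rank_weight v)%N].

(* The dimension of C is taken over K, that of the span in [rank_weight]
   over F. *)
Definition is_code (k d : nat) (C : {vspace 'rV[K]_n}) : bool :=
  [&& (0 < k)%N, \dim C == k & has_min_distance C d].

End Codes.

(* Main.v *)
(* Fix a nonzero F-linear form mu on L.  Writing a code C as the row space of a
   k x mk matrix G over L, every nonzero codeword has full rank weight m if and
   only if no nonzero u satisfies mu(uG) = 0 entrywise: every F-linear form on L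
   is mu(a _) for some a, so a codeword uG with entries in a hyperplane of L
   yields a multiple of u killed by mu.  As u |-> mu(uG) is an F-linear map
   between spaces of dimension mk, and G |-> (u |-> mu(uG)) is injective, hence
   bijective by counting, the good matrices G correspond to GL_mk(F).  Each code
   comes from |GL_k(L)| of them. *)

From HB Require Import structures.
Require Import Defs.
From mathcomp Require Import all_boot all_order all_algebra all_fingroup all_field.

Set Implicit Arguments.
Unset Strict Implicit.
Unset Printing Implicit Defensive.

Import GRing.Theory Num.Theory.
Local Open Scope ring_scope.

Lemma card_finvect (F : finFieldType) (L : fieldExtType F) :
  #|finvect_type L| = (#|F| ^ \dim {:finvect_type L})%N.
Proof. by rewrite -card_vspace card_vspacef. Qed.

(** * Linear forms on the extension field and rank weight *)

Section LinearForm.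

Variables (F : finFieldType) (L : fieldExtType F).
Local Notation K := (finvect_type L).
Local Notation b := (vbasis {:K}).
Local Notation m := (\dim {:K}).

Variable mu : {linear K -> F^o}.
Hypothesis mu_neq0 : exists x, mu x != 0.

(** The pairing [(x, y) |-> mu (x * y)] is nondegenerate: for [a != 0] every [x] is [(x / a) * a],
    so [mu] would vanish everywhere. *)
Lemma linear_form_mul_eq0 (a : K) : (forall i : 'I_m, mu (b`_i * a) = 0) -> a = 0.
Proof.
move=> mu0; apply/eqP; apply: contraT => a_neq0.
have [x /negP[]] := mu_neq0; apply/eqP.
rewrite -[x](divfK a_neq0) (coord_vbasis (memvf (x / a))) mulr_suml linear_sum.
by apply: big1 => i _; rewrite -scalerAl linearZ /= mu0 scaler0.
Qed.

Lemma subspace_annihilator (U : {vspace K}) :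
  (\dim U < m)%N -> exists2 a : K, a != 0 & forall u, u \in U -> mu (a * u) = 0.
Proof.
move=> ltUm.
pose M : 'M[F]_(m, \dim U) := \matrix_(i, j) mu (b`_i * (vbasis U)`_j).
have: kermx M != 0.
  (* [M] has [m] rows and fewer columns, so its left kernel is nonzero; a kernel vector gives the
     coordinates of [a] in the basis [b]. *)
  rewrite kermx_eq0 /row_free; apply: contraTN ltUm => /eqP <-.
  by rewrite -leqNgt rank_leq_col.
case/rowV0Pn=> w /sub_kermxP wM w_neq0.
exists (\sum_i w 0 i *: b`_i) => [|u Uu].
  apply: contraNneq w_neq0 => sum0; apply/eqP/rowP=> i; rewrite mxE.
  by have /freeP := basis_free (vbasisP {:K}); apply; exact: sum0.
rewrite (coord_vbasis Uu) mulr_sumr linear_sum big1 // => j _.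
have /rowP/(_ j) := wM; rewrite !mxE => wMj.
rewrite -scalerAr linearZ /= mulr_suml linear_sum.
under eq_bigr => i _ do rewrite -scalerAl linearZ.
have -> : \sum_i w 0 i *: (mu (b`_i * (vbasis U)`_j) : F^o) = 0.
  by rewrite -[RHS]wMj; apply: eq_bigr => i _; rewrite mxE.
by rewrite scaler0.
Qed.

Lemma full_rank_weight_form_neq0 (n : nat) (v : 'rV[K]_n) :
  rank_weight v = m -> ~ (forall i, mu (v 0 i) = 0).
Proof.
move=> rv mu0; have [x /negP[]] := mu_neq0; apply/eqP.
have Vx : x \in <<[seq v 0%R i | i : 'I_n]>>%VS.
  by have -> : <<[seq v 0%R i | i : 'I_n]>>%VS = {:K}%VS :> {vspace K};
    [apply/eqP; rewrite eqEdim subvf /= -rv | exact: memvf].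
rewrite (coord_span (X := in_tuple _) Vx) linear_sum big1 // => i _.
rewrite linearZ /=.
have /mapP[j _ ->] := mem_nth 0 (ltn_ord i).
by rewrite mu0 scaler0.
Qed.

Lemma rank_weight_le (n : nat) (v : 'rV[K]_n) : (rank_weight v <= m)%N.
Proof. exact: dimvS (subvf _). Qed.

(** * Restriction of scalars from [K] to [F] *)

Definition recompose k (w : 'rV[F]_(m * k)) : 'rV[K]_k :=
  \row_j \sum_i vec_mx w i j *: b`_i.

Lemma recompose_eq0 k (w : 'rV[F]_(m * k)) : recompose w = 0 -> w = 0.
Proof.
move=> /rowP w0; rewrite -[w]vec_mxK -[RHS](linear0 mxvec); congr mxvec.
apply/matrixP=> i j; rewrite [RHS]mxE.
have /freeP/(_ (vec_mx w ^~ j)) := basis_free (vbasisP {:K}); apply.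
by have := w0 j; rewrite !mxE.
Qed.

Lemma recompose_surj k (u : 'rV[K]_k) : exists w, recompose w = u.
Proof.
exists (mxvec (\matrix_(i, j) coord b i (u 0 j))).
apply/rowP=> j; rewrite mxE mxvecK [RHS](coord_vbasis (memvf _)).
by apply: eq_bigr => i _; rewrite mxE.
Qed.

Fact recompose_is_zmod_morphism k : zmod_morphism (@recompose k).
Proof.
move=> u v; apply/rowP=> j; rewrite !mxE -sumrB.
by apply: eq_bigr => i _; rewrite linearB !mxE scalerBl.
Qed.

HB.instance Definition _ k := GRing.isZmodMorphism.Build 'rV[F]_(m * k) 'rV[K]_k
  (@recompose k) (@recompose_is_zmod_morphism k).

(** With additivity this gives [F]-linearity; the target is a space over [K], so the scalar enters
    as [a%:A]. *)
Lemma recomposeZ k a (w : 'rV[F]_(m * k)) : recompose (a *: w) = a%:A *: recompose w.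
Proof.
apply/rowP=> j; rewrite !mxE mulr_sumr; apply: eq_bigr => i _.
by rewrite linearZ mxE mulr_algl scalerA.
Qed.

(* The matrix over F of the map u |-> mu(uG). *)
Definition shadow k n (G : 'M[K]_(k, n)) : 'M[F]_(m * k, n) :=
  \matrix_(r, l) mu ((recompose (delta_mx 0 r) *m G) 0 l).

Lemma mul_shadow k n (G : 'M[K]_(k, n)) (w : 'rV[F]_(m * k)) (l : 'I_n) :
  (w *m shadow G) 0 l = mu ((recompose w *m G) 0 l).
Proof.
rewrite [w in RHS]row_sum_delta raddf_sum mulmx_suml summxE linear_sum mxE.
apply: eq_bigr => r _; rewrite mxE /= recomposeZ -scalemxAl.
by rewrite [X in _ = mu X]mxE mulr_algl linearZ.
Qed.

Lemma shadow_unit k (G : 'M[K]_(k, m * k)) :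
  reflect (forall u : 'rV_k, (forall l, mu ((u *m G) 0 l) = 0) -> u = 0)
    (shadow G \in unitmx).
Proof.
apply: (iffP idP) => [Gu u uG0 | G0].
  have [w def_u] := recompose_surj u; subst u.
  suff -> : w = 0 by rewrite raddf0.
  apply/eqP; rewrite -(@mulmx_free_eq0 _ _ _ _ w (shadow G)) ?row_free_unit //.
  by apply/eqP/rowP=> l; rewrite mul_shadow uG0 mxE.
rewrite -row_free_unit; apply: inj_row_free => w /rowP wG0.
by apply/recompose_eq0/G0 => l; rewrite -mul_shadow wG0 mxE.
Qed.

Lemma shadow_inj k n : injective (@shadow k n).
Proof.
move=> G H /matrixP eqGH; apply/matrixP=> j l; apply/eqP; rewrite -subr_eq0.
apply/eqP/linear_form_mul_eq0 => i.
(* This row of the shadow comes from the vector with [b_i] in position [j] and zeros elsewhere, so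
   equality there reads [mu (b_i * (G j l - H j l)) = 0]. *)
have := eqGH (mxvec_index i j) l.
rewrite /shadow !mxE => /eqP; rewrite -subr_eq0 -linearB -sumrB => /eqP <-.
congr (mu _); rewrite (bigD1 j) //= big1 => [|j' j'j].
  rewrite addr0 -mulrBr; congr (_ * _); rewrite mxE (bigD1 i) //= big1 => [|i' i'i].
    by rewrite -mxvec_delta mxvecK mxE !eqxx scale1r addr0.
  by rewrite -mxvec_delta mxvecK mxE (negPf i'i) scale0r.
rewrite -mulrBr [X in X * _]mxE big1 ?mul0r // => i' _.
by rewrite -mxvec_delta mxvecK mxE (negPf j'j) andbF scale0r.
Qed.

Lemma card_shadow_unit k :
  #|[set G : 'M[K]_(k, m * k) | shadow G \in unitmx]| =
  #|[set A : 'M[F]_(m * k) | A \in unitmx]|.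
Proof.
have [|f fK Kf] := inj_card_bij (@shadow_inj k (m * k)).
  (* Both matrix spaces have [#|F| ^ (m * k * (m * k))] elements. *)
  by rewrite !card_mx card_finvect -expnM !mulnA.
rewrite -(card_imset _ (@shadow_inj k (m * k))); apply: eq_card => A.
rewrite inE; apply/imsetP/idP => [[G] | Au]; first by rewrite inE => Gu ->.
by exists (f A); rewrite ?inE Kf.
Qed.

(** * Codes as row spaces of matrices *)

Definition row_code k n (G : 'M[K]_(k, n)) : {vspace 'rV[K]_n} :=
  limg (linfun (mulmxr G : 'rV_k -> 'rV_n)).

Lemma row_codeP k n (G : 'M[K]_(k, n)) v :
  reflect (exists u : 'rV_k, v = u *m G) (v \in row_code G).
Proof.
apply: (iffP idP) => [/memv_imgP[u _ ->] | [u ->]]; first by exists u; rewrite lfunE.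
by apply/memv_imgP; exists u; rewrite ?memvf ?lfunE.
Qed.

Lemma is_code_row_code k (G : 'M[K]_(k, m * k)) : (0 < k)%N ->
  shadow G \in unitmx -> is_code k m (row_code G).
Proof.
move=> k_gt0 /shadow_unit Gu; apply/and3P; split => //.
  rewrite limg_dim_eq; first by rewrite dimvf /dim /= mul1n.
  rewrite capfv; apply/eqP/lker0P => u v; rewrite !lfunE /= => eq_uv.
  apply/eqP; rewrite -subr_eq0; apply/eqP/Gu => l.
  by rewrite mulmxBl eq_uv subrr mxE linear0.
have rG (u : 'rV_k) : u != 0 -> rank_weight (u *m G) = m.
  move=> u_neq0; apply/eqP; rewrite eqn_leq rank_weight_le leqNgt.
  (* If the entries of [u *m G] span a proper subspace, [mu (a * _)] kills them, and [a *: u]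
     contradicts invertibility of the shadow. *)
  apply/negP => /subspace_annihilator[a a_neq0 aG].
  have/eqP: a *: u = 0.
    by apply: Gu => l; rewrite -scalemxAl mxE aG // memv_span // map_f // mem_enum.
  by rewrite scaler_eq0 (negPf a_neq0) (negPf u_neq0).
apply/andP; split.
  apply/existsP; exists (const_mx 1 *m G).
  have u_neq0 : const_mx 1 != 0 :> 'rV[K]_k.
    by apply/rV0Pn; exists (Ordinal k_gt0); rewrite mxE oner_neq0.
  rewrite rG // eqxx andbT; apply/andP; split.
    by apply/row_codeP; exists (const_mx 1).
  apply: contraNneq u_neq0 => G0; apply/eqP/Gu => l.
  by rewrite G0 mxE linear0.
apply/forallP=> v; apply/implyP=> /andP[/row_codeP[u ->]] uG; rewrite rG //.
by apply: contraNneq uG => ->; rewrite mul0mx.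
Qed.

Lemma vspace_row_code n (C : {vspace 'rV[K]_n}) :
  exists G : 'M[K]_(\dim C, n), C = row_code G.
Proof.
exists (\matrix_(i < \dim C) (vbasis C)`_i); apply/vspaceP => v.
apply/idP/row_codeP => [Cv | [u ->]].
  exists (\row_i coord (vbasis C) i v); rewrite mulmx_sum_row [LHS](coord_vbasis Cv).
  by apply: eq_bigr => i _; rewrite mxE rowK.
rewrite mulmx_sum_row; apply: memv_suml => i _; rewrite rowK memvZ //.
by rewrite vbasis_mem // mem_nth // size_tuple.
Qed.

Lemma row_code_shadow_unit k (G : 'M[K]_(k, m * k)) :
  is_code k m (row_code G) -> shadow G \in unitmx.
Proof.
case/and3P=> _ /eqP dimG /andP[_ /forallP minG]; apply/shadow_unit => u uG0.
(* Rank-nullity: the image has dimension [k], like the source. *)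
have inj_G : injective (linfun (mulmxr G : 'rV_k -> 'rV_(m * k))).
  apply/lker0P; rewrite -dimv_eq0 -[lker _]capfv.
  have /eqP := limg_ker_dim (linfun (mulmxr G : 'rV_k -> 'rV_(m * k))) fullv.
  have -> : \dim {:'rV[K]_k} = k by rewrite dimvf /dim /= mul1n.
  by rewrite dimG -[X in _ == X]add0n eqn_add2r.
(* The minimum distance only constrains nonzero words, so [u *m G = 0] is settled by injectivity. *)
have [/eqP uG | uG] := boolP (u *m G == 0).
  by apply: inj_G; rewrite !lfunE /= uG mul0mx.
have := minG (u *m G); rewrite uG andbT => /implyP min_uG.
case: (@full_rank_weight_form_neq0 _ (u *m G)) => //; apply/eqP.
by rewrite eqn_leq rank_weight_le min_uG //; apply/row_codeP; exists u.
Qed.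

Lemma shadow_unit_row_free k (G : 'M[K]_(k, m * k)) :
  shadow G \in unitmx -> row_free G.
Proof.
move=> /shadow_unit Gu; apply: inj_row_free => u uG; apply: Gu => l.
by rewrite uG mxE linear0.
Qed.

Lemma row_code_mulmx k n (A : 'M[K]_k) (G : 'M[K]_(k, n)) :
  A \in unitmx -> row_code (A *m G) = row_code G.
Proof.
move=> Au; apply/vspaceP => v; apply/row_codeP/row_codeP => [[u ->] | [u ->]].
  by exists (u *m A); rewrite mulmxA.
by exists (u *m invmx A); rewrite mulmxA mulmxKV.
Qed.

Lemma row_code_sub k n (G H : 'M[K]_(k, n)) :
  (row_code H <= row_code G)%VS -> exists A : 'M[K]_k, H = A *m G.
Proof.
move=> /subvP sHG; apply/submxP/row_subP => i; apply/submxP/row_codeP/sHG.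
by apply/row_codeP; exists (delta_mx 0 i); rewrite -rowE.
Qed.

Lemma card_row_code_fiber k (G : 'M[K]_(k, m * k)) : (0 < k)%N ->
  shadow G \in unitmx ->
  #|[set H : 'M[K]_(k, m * k) | (shadow H \in unitmx) && (row_code H == row_code G)]| =
  #|[set A : 'M[K]_k | A \in unitmx]|.
Proof.
move=> k_gt0 Gu.
(* As [G] is row free, [A |-> A *m G] is injective, and the fiber is its image on invertible
   matrices. *)
rewrite -(card_imset _ (row_free_inj (shadow_unit_row_free Gu))).
apply: eq_card => H; rewrite inE; apply/andP/imsetP => [[Hu /eqP eqHG] | [A]].
  have [|A defH] := @row_code_sub _ _ G H; first by rewrite eqHG.
  exists A => //; rewrite inE -row_free_unit; apply: inj_row_free => u uA.
  apply/eqP; rewrite -(mulmx_free_eq0 u (shadow_unit_row_free Hu)) defH mulmxA.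
  by rewrite uA mul0mx.
rewrite inE => Au ->; rewrite row_code_mulmx //; split=> //.
by apply: row_code_shadow_unit; rewrite row_code_mulmx // is_code_row_code.
Qed.

Lemma card_codes k : (0 < k)%N ->
  (#|[set C : {vspace 'rV[K]_(m * k)} | is_code k m C]| *
   #|[set A : 'M[K]_k | A \in unitmx]|)%N =
  #|[set A : 'M[F]_(m * k) | A \in unitmx]|.
Proof.
move=> k_gt0; rewrite -card_shadow_unit -[RHS]sum1_card.
rewrite (partition_big (@row_code k (m * k)) (fun C => C \in [set C | is_code k m C])) /=.
  rewrite -sum_nat_const; apply: eq_bigr => C; rewrite inE => codeC.
  have /and3P[_ /eqP dimC _] := codeC.
  (* The basis matrix has [\dim C] rows; this becomes [k] before [C] is substituted. *)
  have [G defC] := vspace_row_code C; move: G defC; rewrite dimC => G defC.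
  subst C.
  rewrite sum1_card -(card_row_code_fiber k_gt0 (row_code_shadow_unit codeC)).
  by apply: eq_card => H; rewrite inE [RHS]unfold_in /= inE.
by move=> G; rewrite !inE; apply: is_code_row_code.
Qed.

End LinearForm.

(** * Orders of general linear groups *)

Lemma card_GL_unitmx (R : finComUnitRingType) (n : nat) : (0 < n)%N ->
  #|'GL_n[R]%g| = #|[set A : 'M[R]_n | A \in unitmx]|.
Proof.
(* The type behind ['GL_n] consists of matrices of size [n.-1.+1], which is [n] only for positive
   [n]. *)
by case: n => // n _; rewrite cardsT card_sub cardsE.
Qed.

Lemma card_unitmx (F : finFieldType) (n : nat) : (0 < n)%N ->
  (#|[set A : 'M[F]_n | A \in unitmx]|%:R : rat) =
  \prod_(0 <= i < n) (#|F|%:R ^+ n - #|F|%:R ^+ i).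
Proof.
move=> n_gt0; rewrite -card_GL_unitmx // card_GL //.
(* Reversing the product in [card_GL] and splitting the binomial power of [#|F|] pairs [#|F| ^ i]
   with [#|F| ^ (n - i) - 1]. *)
rewrite big_nat_rev big_add1 -bin2_sum expn_sum -big_split /= natr_prod !big_mkord.
apply: eq_bigr => i _.
have le_in := ltnW (ltn_ord i).
rewrite add1n subSS mulnBr muln1 -expnD subnKC // natrB ?natrX //.
by rewrite leq_pexp2l // ltnW // finNzRing_gt1.
Qed.

Theorem corollary5p6 (q m k : nat) (F : finFieldType) (L : fieldExtType F)
    (hq : #|F| = q) (hm : \dim {:L} = m) (m_gt0 : (0 < m)%N) (k_gt0 : (0 < k)%N) :
  (#|[set C : {vspace 'rV[finvect_type L]_(m * k)} | is_code k m C]|%:R : rat) =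
  #|('GL_(m * k)[F])%g|%:R /
    \prod_(0 <= i < k) (q%:R ^+ (m * k) - q%:R ^+ (m * i)).
Proof.
pose K := finvect_type L; pose b := vbasis {:K}.
have cardK : #|K| = (q ^ m)%N by rewrite card_finvect hq -hm.
have m_pos : (0 < \dim {:K})%N by rewrite hm.
(* Any nonzero form would do; the first coordinate takes the value 1 on the first basis vector. *)
pose mu : {linear K -> F^o} := (coord b (Ordinal m_pos) : {scalar K}).
have mu_neq0 : exists x, mu x != 0.
  exists b`_(Ordinal m_pos); rewrite [mu _](coord_free _ _ (basis_free (vbasisP _))).
  by rewrite eqxx oner_neq0.
have := card_codes mu_neq0 k_gt0.
rewrite [\dim _]hm -(card_GL_unitmx F) ?muln_gt0 ?m_gt0 // => <-.
(* The denominator is the order of the general linear group of degree [k] over [K], a field with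
   [q ^ m] elements. *)
have -> : \prod_(0 <= i < k) (q%:R ^+ (m * k) - q%:R ^+ (m * i)) =
    #|[set A : 'M[K]_k | A \in unitmx]|%:R :> rat.
  by rewrite card_unitmx // cardK natrX; apply: eq_bigr => i _; rewrite !exprM.
rewrite natrM mulfK // pnatr_eq0 -lt0n; apply/card_gt0P; exists 1%:M.
by rewrite inE unitmx1.
Qed.
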